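(* Let $X$ be a metrizable topological space such that the set of all non-isolated points of $X$ is compact. Then $F_4(X)$, with the subspace topology inherited from the free topological group $F(X)$, is a Fréchet-Urysohn space.
   Context: For a non-empty Tychonoff space $X$, $F(X)$ denotes the free topological group over $X$ in the sense of Markov: the abstract free group on the set $X$ endowed with the topological group topology such that $X$ is a subspace of $F(X)$ and every continuous map from $X$ to a topological group $G$ extends (uniquely) to a continuous homomorphism $F(X)\to G$. For $n\in\mathbb{N}$, $F_n(X)$ is the subspace of $F(X)$ consisting of all elements whose reduced word with respect to the free basis $X$ has length at most $n$ (letters are elements of $X\cup X^{-1}$; the empty word is the neutral element $e$). A topological space $Y$ is Fréchet-Urysohn if for every $A\subset Y$ and every $y\in\overline{A}$ there is a sequence of points of $A$ converging to $y$. *)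

(* Defs.v *)
From HB Require Import structures.
From mathcomp Require Import all_boot all_order all_algebra.
From mathcomp Require Import all_classical all_reals all_analysis.

Set Implicit Arguments.
Unset Strict Implicit.
Unset Printing Implicit Defensive.

Local Open Scope classical_set_scope.

HB.structure Definition PreTopologicalGroup := {G of Topological G & Group G}.

HB.mixin Record isTopologicalGroup G & PreTopologicalGroup G := {
  mulg_continuous : continuous (fun x : G * G => (x.1 * x.2)%g) ;
  invg_continuous : continuous (fun x : G => (x^-1)%g)
}.

(* No separation axiom is imposed. *)
#[short(type="topologicalGroupType")]
HB.structure Definition TopologicalGroup :=
  {G of PreTopologicalGroup G & isTopologicalGroup G}.

Definition metrizable (R : realType) (X : topologicalType) : Prop :=
  exists (M : metricType R) (h : X -> M),
    bijective h /\ forall A : set M, open A <-> open (h @^-1` A).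

Definition frechet_urysohn (Y : topologicalType) : Prop :=
  forall (A : set Y) (y : Y), closure A y ->
    exists u : nat -> Y, (forall n, A (u n)) /\ u @ \oo --> y.

Section Words.
Variables (X : choiceType) (F : groupType) (iota : X -> F).

(* The letter (x, true) stands for x, and (x, false) for its inverse. *)
Definition cancelling (a b : X * bool) : bool := (a.1 == b.1) && (a.2 != b.2).

Definition reduced (w : seq (X * bool)) : bool :=
  sorted (fun a b => ~~ cancelling a b) w.

Definition letter_val (l : X * bool) : F :=
  if l.2 then iota l.1 else ((iota l.1)^-1)%g.

Definition word_val (w : seq (X * bool)) : F :=
  (\prod_(l <- w) letter_val l)%g.

(* F is the abstract free group with free basis iota : X -> F. *)
Definition free_basis : Prop :=
  forall g : F, exists! w : seq (X * bool), reduced w /\ word_val w = g.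

Definition word_length_le (n : nat) : set F :=
  [set word_val w | w in [set w | reduced w /\ (size w <= n)%N]].

End Words.

(* (F, iota) is the Markov free topological group over X; this determines it up
   to a topological isomorphism compatible with the inclusions of X. *)
Record is_free_topological_group (X : topologicalType)
    (F : topologicalGroupType) (iota : X -> F) : Prop := {
  ftg_free_basis : free_basis iota ;
  ftg_subspace : forall A : set X,
    open A <-> exists2 U : set F, open U & iota @^-1` U = A ;
  ftg_extension : forall (G : topologicalGroupType) (f : X -> G),
    continuous f ->
    exists! phi : F -> G,
      [/\ {morph phi : a b / (a * b)%g}, continuous phi & phi \o iota = f]
}.

(* Main.v *)
From HB Require Import structures.
Require Import Defs.
From mathcomp Require Import all_boot all_order all_algebra.
From mathcomp Require Import all_classical all_reals all_analysis.

(** Let [K] be the compact set of non-isolated points of [X], let [A] be a set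
of words of length at most 4 and [g] a point of its closure. Take an ultrafilter
[U] containing [A] and converging to [g], and read the reduced words [u] letter
by letter along [U]. Apply [ultra_closed_or_cvg] to each letter, with [L] the
union of [K], the letters of [g] and one more point.

Either every letter converges. As [X] is first countable, a sequence in [A] can
be extracted whose letters converge to the same limits ([countably_cvg] records
this), so that it converges in [F] to some [b]. Both [g] and [b] are limits of
[U], and in a topological group two limits of one filter have the same
neighbourhoods ([nbhs_sub_of_common_limit]); the sequence thus converges to [g].
This is [far_or_sequence].

Or, along [U], the words have a letter in a closed set [D] of isolated points
that contains neither a letter of [g] nor the extra point. Maps on [X] may be
chosen freely on [D], which is clopen and discrete, and if continuous they extend
to continuous homomorphisms on [F]. Collapsing [X] outside [D] to the extra point,
with values in the discrete free group, shows that the letters from [D] cancel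
once the others are identified. In a reduced word of length at most 4 this leaves
only the shape
[x y z^-1 x^-1] up to signs, with [x] in [D] and [y], [z] outside
([nested_cancellation], [far_nested]). So [u] is a conjugate [h b h^-1] with [b]
of length 2. Killing [D] sends [u] to [b] and fixes [g].

The point is that [b] tends to 1 as fast as one wishes in terms of [h]
([far_conjugates]): for every family [V h] of neighbourhoods of 1, [b] is in
[V h] along [U]. This is seen in the semidirect product of a discrete copy of
[F] with the box power [F -> F] that it shifts ([wreath]): send [x] in [D] to the
discrete factor, and the other letters to the coordinate of index 1; then
[h b h^-1] has [b] as its coordinate of index [h], and the neighbourhoods of the
box topology can be chosen separately in each coordinate. If for every [h] some
neighbourhood [V h] missed the [b] of length 2 with [h b h^-1] in [A], this would be
contradicted. Hence there is one [h] for which 1 is in the closure of these [b].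
Words of length 2 cannot have the nested shape, so the first alternative gives a
sequence of such [b] converging to 1, and its conjugates by [h] lie in [A] and
converge to 1. Finally [g] and 1 have the same neighbourhoods, since both are
limits along [U] of the words with [D] killed. *)

Set Implicit Arguments.
Unset Strict Implicit.
Unset Printing Implicit Defensive.

Local Open Scope classical_set_scope.
Local Open Scope group_scope.

(** * The wreath product with the box topology *)

(** The unrestricted wreath product of [B] by [Gamma], where [Gamma] is discrete
and shifts the indices of [Gamma -> B] by left multiplication. *)
Definition wreath (B : Type) (Gamma : Type) : Type := ((Gamma -> B) * Gamma)%type.

Section WreathTopology.
Variables (B : topologicalType) (Gamma : choiceType).
Local Notation W := (wreath B Gamma).

HB.instance Definition _ := gen_eqMixin W.
HB.instance Definition _ := gen_choiceMixin W.

(** The box topology on [Gamma -> B]: the product topology would not let the size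
of a neighbourhood depend on the coordinate. *)
Definition wreath_nbhs (p : W) : set_system W :=
  [set A | exists2 V : Gamma -> set B, (forall h, nbhs (p.1 h) (V h)) &
    forall v : Gamma -> B, (forall h, V h (v h)) -> A (v, p.2)].

HB.instance Definition _ := hasNbhs.Build W wreath_nbhs.

Let wreath_nbhs_filter (p : W) : ProperFilter (nbhs p).
Proof.
apply: Build_ProperFilter_ex.
  move=> A [V pV VA]; exists p; rewrite [p]surjective_pairing.
  by apply: VA => h; exact: nbhs_singleton.
split.
- by exists (fun=> setT) => // h; exact: filterT.
- move=> P Q [V pV VP] [V' pV' VQ].
  exists (fun h => V h `&` V' h) => [h|v vV]; first exact: filterI.
  by split; [apply: VP => h; case: (vV h)|apply: VQ => h; case: (vV h)].
- move=> P Q PQ [V pV VP]; exists V => // v vV.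
  exact/PQ/VP.
Qed.

Let wreath_nbhs_singleton (p : W) (A : set W) : nbhs p A -> A p.
Proof.
move=> [V pV VA]; rewrite [p]surjective_pairing.
by apply: VA => h; exact: nbhs_singleton.
Qed.

Let wreath_nbhs_nbhs (p : W) (A : set W) : nbhs p A -> nbhs p (nbhs^~ A).
Proof.
move=> [V pV VA]; exists (fun h => (V h)^°).
  by move=> h; exact: nbhs_interior.
by move=> v vV; exists V.
Qed.

HB.instance Definition _ := Nbhs_isNbhsTopological.Build W
  wreath_nbhs_filter wreath_nbhs_singleton wreath_nbhs_nbhs.

End WreathTopology.

Section WreathGroup.
Variables (B : topologicalGroupType) (Gamma : groupType).
Local Notation W := (wreath B Gamma).

Definition wreath_one : W := (fun=> 1, 1).
Definition wreath_mul (p q : W) : W :=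
  (fun h => p.1 h * q.1 (p.2^-1 * h), p.2 * q.2).
Definition wreath_inv (p : W) : W := (fun h => (p.1 (p.2 * h))^-1, p.2^-1).

Let wreath_mulA : associative wreath_mul.
Proof.
move=> p q r; congr (_, _); last exact: mulgA.
by apply/funext => h /=; rewrite invgM !mulgA.
Qed.

Let wreath_mul1g : left_id wreath_one wreath_mul.
Proof.
by case=> v x; congr (_, _); rewrite ?mul1g//=; apply/funext => h /=;
  rewrite invg1 !mul1g.
Qed.

Let wreath_mulg1 : right_id wreath_one wreath_mul.
Proof.
by case=> v x; congr (_, _); rewrite ?mulg1//=; apply/funext => h /=;
  rewrite mulg1.
Qed.

Let wreath_mulVg : left_inverse wreath_one wreath_inv wreath_mul.
Proof.
case=> v x; congr (_, _); rewrite ?mulVg//=; apply/funext => h /=.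
by rewrite invgK mulVg.
Qed.

Let wreath_mulgV : right_inverse wreath_one wreath_inv wreath_mul.
Proof.
case=> v x; congr (_, _); rewrite ?mulgV//=; apply/funext => h /=.
by rewrite mulVKg mulgV.
Qed.

HB.instance Definition _ := isGroup.Build W
  wreath_mulA wreath_mul1g wreath_mulg1 wreath_mulVg wreath_mulgV.

Let wreath_mul_continuous : continuous (fun x : W * W => (x.1 * x.2)%g).
Proof.
move=> [p q] A [V pqV VA].
have /choice [PQ hPQ] h : exists PQ : set B * set B,
    [/\ nbhs (p.1 h) PQ.1, nbhs (q.1 (p.2^-1 * h)) PQ.2 &
     forall a b, PQ.1 a -> PQ.2 b -> V h (a * b)].
  have [[P Q] /= [nP nQ] PQV] :=
    @mulg_continuous B (p.1 h, q.1 (p.2^-1 * h)) _ (pqV h).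
  by exists (P, Q); split => // a b Pa Qb; exact: (PQV (a, b)).
exists ([set r : W | (forall h, (PQ h).1 (r.1 h)) /\ r.2 = p.2],
        [set r : W | (forall h, (PQ (p.2 * h)).2 (r.1 h)) /\ r.2 = q.2]) => /=.
  split.
  - by exists (fun h => (PQ h).1) => // h; case: (hPQ h).
  - exists (fun h => (PQ (p.2 * h)).2) => // h.
    by case: (hPQ (p.2 * h)); rewrite mulKg.
move=> [[v x] [v' y]] /= [[vP ->] [v'Q ->]].
apply: VA => h /=; have [_ _] := hPQ h; apply; first exact: vP.
by have := v'Q (p.2^-1 * h); rewrite mulVKg.
Qed.

Let wreath_inv_continuous : continuous (fun x : W => (x^-1)%g).
Proof.
move=> p A [V pV VA].
exists (fun h => (fun b : B => b^-1) @^-1` V (p.2^-1 * h)).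
  move=> h; apply: (@invg_continuous B (p.1 h)).
  by have := pV (p.2^-1 * h); rewrite /= mulVKg.
move=> v vV; apply: VA => h /=.
by have := vV (p.2 * h); rewrite /= mulKg.
Qed.

HB.instance Definition _ := isTopologicalGroup.Build W
  wreath_mul_continuous wreath_inv_continuous.

End WreathGroup.

(** * Reduced words with nested cancellation *)

Section WordValues.
Variables (X : choiceType) (F : groupType) (iota : X -> F).
Implicit Types (w u v : seq (X * bool)) (l : X * bool).

Lemma word_val_nil : word_val iota [::] = 1.
Proof. by rewrite /word_val big_nil. Qed.

Lemma word_val_cons l w :
  word_val iota (l :: w) = letter_val iota l * word_val iota w.
Proof. by rewrite /word_val big_cons. Qed.

Lemma letter_val_cancelling (a b : X * bool) :
  cancelling a b -> letter_val iota a * letter_val iota b = 1.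
Proof.
case: a b => [x s] [y t] /andP[/= /eqP <-]; rewrite /letter_val /=.
by case: s t => [] [] //= _; rewrite (mulgV, mulVg).
Qed.

Lemma exists_reduced w : exists v,
  [/\ reduced v, word_val iota v = word_val iota w & {subset v <= w}].
Proof.
elim: w => [|l w [v [rv vw vsub]]]; first by exists [::].
case: v rv vw vsub => [|m v] rv vw vsub.
  exists [:: l]; split => //; first by rewrite !word_val_cons vw.
  by move=> k; rewrite !inE => ->.
have [cl|ncl] := boolP (cancelling l m).
  exists v; split; first exact: path_sorted rv.
    by rewrite word_val_cons -vw word_val_cons mulgA letter_val_cancelling ?mul1g.
  by move=> k kv; rewrite inE vsub ?orbT// inE kv orbT.
exists [:: l, m & v]; split; first by rewrite /reduced /= ncl.
  by rewrite [LHS]word_val_cons vw -word_val_cons.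
move=> k; rewrite [in X in X -> _]inE => /orP[/eqP ->|/vsub kw].
  exact: mem_head.
by rewrite inE kw orbT.
Qed.

Hypothesis basis : free_basis iota.

(** Reducing a word only deletes letters, and the reduced word is unique. *)
Lemma reduced_subset u v :
  reduced v -> word_val iota v = word_val iota u -> {subset v <= u}.
Proof.
move=> rv vu; have [u' [ru' u'u sub]] := exists_reduced u.
have [w [_ uniq_w]] := basis (word_val iota u).
by rewrite -(uniq_w v (conj rv vu)) (uniq_w u' (conj ru' u'u)).
Qed.

Lemma letter_val_neq1 l : letter_val iota l != 1.
Proof.
apply/eqP => l1.
have : l \in [::]; last by [].
apply: (@reduced_subset [::] [:: l]) => //; last exact: mem_head.
by rewrite word_val_cons word_val_nil l1 mulg1.
Qed.

Variables (D : pred X) (p : X).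
Hypothesis pND : ~~ D p.

Let r l : X * bool := (if D l.1 then l.1 else p, l.2).

Let D_r l : D (r l).1 = D l.1.
Proof. by rewrite /r; case: ifP => //= _; exact/negbTE. Qed.

Let cancelling_r a b :
  cancelling (r a) (r b) -> ~~ cancelling a b -> ~~ D a.1 && ~~ D b.1.
Proof.
rewrite /cancelling /r /= => /andP[+ ->]; rewrite andbT.
case: ifP => Da; case: ifP => Db //= /eqP E.
- by rewrite E eqxx.
- by move: pND; rewrite -E Da.
- by move: pND; rewrite E Db.
Qed.

(** Let the letters outside [D] be identified with [p]. A reduced word then never
has a cancelling pair of adjacent letters of which one is in [D]: such a pair
would already cancel before the identification. So the first cancellation is of
two letters outside [D], and at most two letters are left. The value is that of
a word without letters from [D], so the letters from [D] still there have to go: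
the two left must cancel each other. They were not adjacent before,
so the pair deleted first stood between them. *)
Lemma nested_cancellation w u :
  reduced w -> (size w <= 4)%N -> has (fun l => D l.1) w ->
  {in u, forall l, ~~ D l.1} ->
  word_val iota (map r w) = word_val iota (map r u) ->
  exists x s y t z, [/\ w = [:: (x, s); (y, t); (z, ~~ t); (x, ~~ s)],
    D x, ~~ D y & ~~ D z].
Proof.
move=> rw sw Dw uND wu.
have red v : word_val iota v = word_val iota (map r u) ->
    has (fun l => D l.1) v -> ~~ reduced v.
  move=> vu /hasP[l lv Dl]; apply/negP => /reduced_subset /(_ vu) /(_ _ lv).
  by case/mapP => k /uND kND E; move: Dl; rewrite E D_r (negbTE kND).
have red1 a : word_val iota [:: r a] = word_val iota (map r u) -> ~~ D a.1.
  by move=> /red /=; rewrite D_r orbF; case: (D a.1) => // /(_ isT).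
have red2 a b : word_val iota [:: r a; r b] = word_val iota (map r u) ->
    ~~ cancelling a b -> ~~ D a.1 && ~~ D b.1.
  move=> /red /=; rewrite !D_r orbF -negb_or => nr nab.
  apply/negP => Dab; move: (nr Dab); rewrite /reduced /= andbT negbK => rc.
  by move: Dab; have := cancelling_r rc nab; rewrite -negb_or => /negbTE ->.
have cancel2 a b v1 v2 : cancelling (r a) (r b) ->
    word_val iota (v1 ++ [:: r a; r b] ++ v2) = word_val iota (v1 ++ v2).
  move=> ab; rewrite /word_val !big_cat !big_cons !big_nil /=.
  by rewrite mulg1 letter_val_cancelling// mul1g.
have := red _ wu; rewrite has_map (eq_has (a2 := fun l => D l.1)); last first.
  by move=> l /=; rewrite D_r.
move=> /(_ Dw); case: w rw sw Dw wu => [|a [|b [|c [|d [|]]]]] //= rw _ Dw wu.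
- move: rw Dw; rewrite /reduced /= !andbT orbF => /(red2 _ _ wu).
  by rewrite -negb_or => /negbTE ->.
- move: rw Dw; rewrite /reduced /= !andbT orbF => /andP[ab bc] Dw.
  rewrite negb_and !negbK => /orP[] rc.
  + have /andP[/negbTE Da /negbTE Db] := cancelling_r rc ab.
    move: wu; rewrite (cancel2 _ _ [::] [:: r c] rc) => /red1.
    by move: Dw; rewrite Da Db /= => ->.
  + have /andP[/negbTE Db /negbTE Dc] := cancelling_r rc bc.
    move: wu; rewrite (cancel2 _ _ [:: r a] [::] rc) => /red1.
    by move: Dw; rewrite Db Dc !orbF => ->.
- move: rw Dw; rewrite /reduced /= !andbT orbF => /and3P[ab bc cd] Dw.
  rewrite -!negb_or negbK => /or3P[] rc.
  + have /andP[/negbTE Da /negbTE Db] := cancelling_r rc ab.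
    move: wu; rewrite (cancel2 _ _ [::] [:: r c; r d] rc) => /red2 /(_ cd).
    by move: Dw; rewrite Da Db /= -negb_or => ->.
  + have /andP[Db Dc] := cancelling_r rc bc.
    move: wu; rewrite (cancel2 _ _ [:: r a] [:: r d] rc) => /red2 Dad.
    move: Dw; rewrite (negbTE Db) (negbTE Dc) /= => Dw.
    have ad : cancelling a d.
      by apply: contraLR Dw => /Dad; rewrite -negb_or.
    case: a b c d ad rc Dw Db Dc {Dad ab bc cd} => [x s] [y t] [z t'] [x' s'].
    rewrite /cancelling /r /= => /andP[/eqP <- ss'] /andP[_ tt'].
    rewrite orbb => Dx Dy Dz; exists x, s, y, t, z; split => //.
    by congr [:: _; _; (_, _); (_, _)]; [case: t t' tt' => [] []|case: s s' ss' => [] []].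
  + have /andP[/negbTE Dc /negbTE Dd] := cancelling_r rc cd.
    move: wu; rewrite (cancel2 _ _ [:: r a; r b] [::] rc) => /red2 /(_ ab).
    by move: Dw; rewrite Dc Dd /= orbF -negb_or => ->.
Qed.
End WordValues.

(** * Convergence along ultrafilters *)

Lemma cvg_mulg (T : Type) (U : set_system T) (G : topologicalGroupType)
    (f g : T -> G) (a b : G) : Filter U ->
  f @ U --> a -> g @ U --> b -> (fun t => f t * g t) @ U --> a * b.
Proof.
move=> UF fa gb; apply: (@cvg_comp _ _ _ (fun t => (f t, g t))
  (fun x => x.1 * x.2) _ (nbhs (a, b))); first exact: cvg_pair.
exact: (@mulg_continuous G (a, b)).
Qed.

Lemma cvg_invg (T : Type) (U : set_system T) (G : topologicalGroupType)
    (f : T -> G) (a : G) : f @ U --> a -> (fun t => (f t)^-1) @ U --> a^-1.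
Proof.
by move=> fa; apply: (@cvg_comp _ _ _ f (fun x => x^-1) _ (nbhs a)) => //;
  exact: invg_continuous.
Qed.

(** Convergence along [U] that is witnessed by countably many members of [U]. A
sequence that meets them in turn converges to the same limit; this is how
sequences are extracted from ultrafilters. *)
Definition countably_cvg (T : Type) (Y : topologicalType) (U : set_system T)
    (f : T -> Y) (b : Y) : Prop :=
  exists2 E : nat -> set T, (forall k, U (E k)) &
    forall u : nat -> T, (forall k, E k (u k)) -> f \o u @ \oo --> b.

Section CountablyCvg.
Variables (T : Type) (U : set_system T).
Context {UP : ProperFilter U}.

(** If some neighbourhood of [b] failed, its complement would be in [U], and a
sequence could be chosen in it through all the witnessing sets. *)
Lemma countably_cvg_cvg (Y : topologicalType) (f : T -> Y) (b : Y) :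
  UltraFilter U -> countably_cvg U f b -> f @ U --> b.
Proof.
move=> UU [E UE Ecvg] V bV.
have [//|UV] := in_ultra_setVsetC (f @^-1` V) UU.
have /choice[u hu] k : exists x, (E k `&` ~` (f @^-1` V)) x.
  by apply: (@filter_ex _ U UP); exact: filterI.
have /Ecvg /(_ V bV) : forall k, E k (u k) by move=> k; case: (hu k).
by move=> [k _ /(_ k (leqnn k))]; case: (hu k).
Qed.

Lemma countably_cvg_cst (Y : topologicalType) (f : T -> Y) (b : Y) :
  U [set t | f t = b] -> countably_cvg U f b.
Proof.
move=> Ufb; exists (fun=> [set t | f t = b]) => // u ub.
by have -> : f \o u = fun=> b; [exact/funext|exact: cvg_cst].
Qed.

Lemma countably_cvg_eq (Y : topologicalType) (f g : T -> Y) (b : Y) :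
  U [set t | f t = g t] -> countably_cvg U g b -> countably_cvg U f b.
Proof.
move=> Ufg [E UE Eb]; exists (fun k => [set t | f t = g t] `&` E k) => [k|u uE].
  exact: filterI.
have -> : f \o u = g \o u by apply/funext => k; case: (uE k).
by apply: Eb => k; case: (uE k).
Qed.

Lemma countably_cvg_mul (G : topologicalGroupType) (f g : T -> G) (a b : G) :
  countably_cvg U f a -> countably_cvg U g b ->
  countably_cvg U (fun t => f t * g t) (a * b).
Proof.
move=> [E UE Ea] [E' UE' E'b]; exists (fun k => E k `&` E' k) => [k|u uE].
  exact: filterI.
by apply: cvg_mulg; [apply: Ea|apply: E'b] => k; case: (uE k).
Qed.

End CountablyCvg.

(** If no closed set disjoint from [L] is in the image of [U], then the closures of
the members of this image trace a proper filter on [L]; by compactness it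
clusters at a point of [L], to which the image of [U] converges. *)
Lemma ultra_closed_or_cvg (T : Type) (U : set_system T) (X : topologicalType)
    (c : T -> X) (L : set X) : UltraFilter U -> compact L ->
  (exists D : set X, [/\ closed D, D `&` L = set0 & U (c @^-1` D)]) \/
  (exists a : X, c @ U --> a).
Proof.
move=> UU cL; have UP : ProperFilter U by exact: ultra_proper.
have [|noD] := pselect (exists D : set X,
  [/\ closed D, D `&` L = set0 & U (c @^-1` D)]); [by left|right].
pose G : set_system X := [set S | exists2 P, U (c @^-1` P) & L `&` closure P `<=` S].
have GP : ProperFilter G.
  apply: Build_ProperFilter_ex => [S [P UP' PS]|].
    apply: contrapT => S0; apply: noD; exists (closure P); split.
    - exact: closed_closure.
    - apply/seteqP; split => // x [Px Lx]; apply: S0; exists x; exact: PS.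
    - by apply: filterS UP' => t; exact: subset_closure.
  split; first by exists setT => //; exact: filterT.
  - move=> S S' [P UP' PS] [P' UP'' PS'].
    exists (P `&` P'); first exact: filterI.
    move=> x [Lx Px]; split; [apply: PS|apply: PS'].
      by split => //; apply: closureS Px => ? [].
    by split => //; apply: closureS Px => ? [].
  - by move=> S S' SS' [P UP' PS]; exists P => // x /PS; exact: SS'.
have GL : G L by exists setT; [exact: filterT|move=> x []].
have [a [La aG]] := cL G GP GL; exists a => N aN.
have [//|UN] := in_ultra_setVsetC (c @^-1` N) UU.
have [x [[Lx clx] Nx]] : (L `&` closure (~` N)) `&` N° !=set0.
  by apply: aG; [exists (~` N)|exact: nbhs_interior].
by have [y []] := clx _ Nx.
Qed.

Lemma metrizable_countable_base (R : realType) (X : topologicalType) :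
  metrizable R X -> exists B : X -> nat -> set X,
    (forall x k, nbhs x (B x k)) /\
    (forall x (u : nat -> X), (forall k, B x k (u k)) -> u @ \oo --> x).
Proof.
move=> [M [h [bij_h openE]]].
have hnbhs x (A : set M) : nbhs (h x) A -> nbhs x (h @^-1` A).
  move=> /nbhs_interior/nbhs_singleton xA.
  apply: (@filterS _ _ _ (h @^-1` A°)) => [y /interior_subset//|].
  by apply: open_nbhs_nbhs; split => //; exact/openE/open_interior.
have [h' hK h'K] := bij_h.
exists (fun x k => h @^-1` ball (h x) (k.+1%:R^-1 : R)%R); split => [x k|x u ub].
  apply: hnbhs; apply: nbhsx_ballx.
  by rewrite Num.Theory.invr_gt0 Num.Theory.ltr0n.
move=> A; rewrite nbhsE => -[V [oV Vx] VA].
have oV' : open (h' @^-1` V).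
  apply/openE; have -> : h @^-1` (h' @^-1` V) = V => //.
  by apply/seteqP; split => y /=; rewrite hK.
have : nbhs (h x) (h' @^-1` V).
  by apply: open_nbhs_nbhs; split => //=; rewrite hK.
move=> /nbhs_ballP[e /= e0 eV].
change (\forall k \near \oo, A (u k)); near=> k; apply: VA; rewrite -[u k]hK; apply: eV.
apply: le_ball (ub k); apply/Order.POrderTheory.ltW; near: k.
exact: near_infty_natSinv_lt (PosNum e0).
Unshelve. all: by end_near. Qed.

Lemma closed_isolated_split_continuous (X Y : topologicalType) (D : set X)
    (f1 f2 : X -> Y) :
  closed D -> (forall x, D x -> nbhs x [set x]) -> continuous f2 ->
  continuous (fun x => if x \in D then f1 x else f2 x).
Proof.
move=> clD isoD cf2 x A fxA.
change (nbhs x [set y | A (if y \in D then f1 y else f2 y)]).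
move: fxA; have [Dx|nDx] := pselect (D x).
  rewrite mem_set// => fxA.
  have := isoD x Dx; apply: filterS => y; rewrite /set1 /= => ->.
  by rewrite mem_set//; exact: (nbhs_singleton fxA).
rewrite memNset// => fxA.
have xD : nbhs x (~` D) by apply: open_nbhs_nbhs; split => //; exact: closed_openC.
have xA : nbhs x (f2 @^-1` A) := cf2 x A fxA.
by apply: filterS2 xD xA => y /= nDy Ay; rewrite memNset.
Qed.

(** The constant [b] equals [f t * (b^-1 * f t)^-1], which tends to [a]: thus every
neighbourhood of [a] contains [b]. *)
Lemma nbhs_sub_of_common_limit (T : Type) (U : set_system T)
    (G : topologicalGroupType) (f : T -> G) (a b : G) : ProperFilter U ->
  f @ U --> a -> f @ U --> b -> nbhs a `<=` nbhs b.
Proof.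
move=> UP fa fb A; rewrite nbhsE => -[V [oV Va] VA].
apply: filterS VA _; apply: open_nbhs_nbhs; split => //.
have : (fun=> b) @ U --> a.
  have -> : (fun=> b : G) = (fun t : T => f t * (b^-1 * f t)^-1).
    by apply/funext => t; rewrite invgM invgK mulVKg.
  have -> : a = a * (b^-1 * b)^-1 by rewrite mulVg invg1 mulg1.
  apply: cvg_mulg => //; apply: cvg_invg; apply: cvg_mulg => //; exact: cvg_cst.
move=> cvg_b; have UV : U (fun=> V b) := cvg_b V (open_nbhs_nbhs (conj oV Va)).
by have [] := @filter_ex _ U UP _ UV.
Qed.

(** * Words, homomorphisms and the maps into the wreath product *)

Section Morphisms.
Variables (X : choiceType) (G H : groupType) (phi : G -> H).
Hypothesis phiM : {morph phi : a b / a * b}.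

Lemma morph1 : phi 1 = 1.
Proof. by apply: (@mulgI _ (phi 1)); rewrite -phiM !mulg1. Qed.

Lemma morphV a : phi a^-1 = (phi a)^-1.
Proof. by apply: (@mulgI _ (phi a)); rewrite -phiM !mulgV morph1. Qed.

Lemma morph_letter_val (iota : X -> G) l :
  letter_val (phi \o iota) l = phi (letter_val iota l).
Proof. by rewrite /letter_val /=; case: ifP; rewrite ?morphV. Qed.

Lemma morph_word_val (iota : X -> G) w :
  word_val (phi \o iota) w = phi (word_val iota w).
Proof.
elim: w => [|l w IHw]; first by rewrite !word_val_nil morph1.
by rewrite !word_val_cons IHw phiM morph_letter_val.
Qed.

End Morphisms.

Section MoreWords.
Variables (X : choiceType) (G : groupType) (iota : X -> G).

Lemma letter_valN x s : letter_val iota (x, ~~ s) = (letter_val iota (x, s))^-1.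
Proof. by case: s; rewrite /letter_val /= ?invgK. Qed.

Lemma eq_word_val (f : X -> G) w :
  {in w, forall l, f l.1 = iota l.1} -> word_val f w = word_val iota w.
Proof.
move=> fw; rewrite /word_val; apply: eq_big_seq => l /fw.
by rewrite /letter_val => ->.
Qed.

Lemma word_val_map (r : X -> X) w :
  word_val (iota \o r) w = word_val iota [seq (r l.1, l.2) | l <- w].
Proof. by rewrite /word_val big_map. Qed.

End MoreWords.

Section WreathMaps.
Variables (B : topologicalGroupType) (Gamma : groupType).
Local Notation W := (wreath B Gamma).

Definition wreath_base (b : B) : W := (fun h => if h == 1 then b else 1, 1).
Definition wreath_top (x : Gamma) : W := (fun=> 1, x).

Lemma wreath_baseM : {morph wreath_base : a b / a * b}.
Proof.
move=> a b; congr (_, _); last by rewrite /= mulg1.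
by apply/funext => h /=; rewrite invg1 mul1g; case: ifP; rewrite ?mulg1.
Qed.

Lemma wreath_topM : {morph wreath_top : a b / a * b}.
Proof. by move=> a b; congr (_, _); apply/funext => h /=; rewrite mulg1. Qed.

Lemma wreath_sndM : {morph (snd : W -> Gamma) : a b / a * b}.
Proof. by []. Qed.

Lemma wreath_base_continuous : continuous wreath_base.
Proof.
move=> b A [V bV VA].
have := bV 1; rewrite /= eqxx => /(@filterS _ _ _); apply => b' Vb'.
apply: VA => h; have := bV h; rewrite /=; case: eqP => [-> //|_].
exact: nbhs_singleton.
Qed.

(** Conjugation by [x] moves the coordinate of index 1 to the index [x]. *)
Lemma wreath_conj x b :
  (wreath_top x * wreath_base b * (wreath_top x)^-1).1 x = b.
Proof. by rewrite /= mulVg eqxx invg1 mul1g mulg1. Qed.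

End WreathMaps.

Section Dichotomy.
Variables (X : topologicalType) (F : topologicalGroupType) (iota : X -> F).
Variables (B : X -> nat -> set X).
Hypothesis B_nbhs : forall x k, nbhs x (B x k).
Hypothesis B_cvg : forall x (u : nat -> X), (forall k, B x k (u k)) -> u @ \oo --> x.
Hypothesis iota_continuous : continuous iota.
Variables (T : Type) (U : set_system T) (L : set X) (p : X).
Hypothesis UU : UltraFilter U.
Hypothesis cL : compact L.

Lemma letter_dichotomy (q : T -> X * bool) :
  (exists D : set X, [/\ closed D, D `&` L = set0 & U [set t | D (q t).1]]) \/
  (exists b, countably_cvg U (fun t => letter_val iota (q t)) b).
Proof.
have UP : ProperFilter U by exact: ultra_proper.
have [|[a qa]] := ultra_closed_or_cvg (fun t => (q t).1) UU cL; [by left|right].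
have [s Us] : exists s, U [set t | (q t).2 = s].
  have [Ut|Uf] := in_ultra_setVsetC [set t | (q t).2 = true] UU.
    by exists true.
  by exists false; apply: filterS Uf => t /=; case: (q t).2.
exists (letter_val iota (a, s)).
exists (fun k => [set t | B a k (q t).1] `&` [set t | (q t).2 = s]) => [k|u uE].
  by apply: filterI => //; apply: qa; exact: B_nbhs.
have -> : (fun t => letter_val iota (q t)) \o u =
    fun k => letter_val iota ((q (u k)).1, s).
  by apply/funext => k /=; case: (uE k) => _ /= <-; case: (q (u k)).
have ua : iota (q (u k)).1 @[k --> \oo] --> iota a.
  apply: (@cvg_comp _ _ _ (fun k => (q (u k)).1) iota _ (nbhs a)).
    by apply: B_cvg => k; case: (uE k).
  exact: iota_continuous.
by rewrite /letter_val /=; case: s {Us uE}; [|exact: cvg_invg].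
Qed.

Lemma word_dichotomy (n : nat) (q : T -> seq (X * bool)) :
  U [set t | (size (q t) <= n)%N] ->
  (exists D : set X, [/\ closed D, D `&` L = set0 &
     U [set t | has (fun l => l.1 \in D) (q t)]]) \/
  (exists b, countably_cvg U (fun t => word_val iota (q t)) b).
Proof.
have UP : ProperFilter U by exact: ultra_proper.
elim: n q => [|n IHn] q Uq.
  right; exists 1; apply: countably_cvg_cst; apply: filterS Uq => t /=.
  by rewrite leqn0 size_eq0 => /eqP ->; exact: word_val_nil.
have [Unil|Ucons] := in_ultra_setVsetC [set t | q t = [::]] UU.
  right; exists 1; apply: countably_cvg_cst; apply: filterS Unil => t /= ->.
  exact: word_val_nil.
have [|[D [clD DL UD]]|[b qb]] := IHn (behead \o q).
- by apply: filterS Uq => t /=; rewrite size_behead; case: (size _).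
- left; exists D; split => //; apply: filterS UD => t /=.
  by case: (q t) => //= l w ->; rewrite orbT.
have [[D [clD DL UD]]|[a qa]] := letter_dichotomy (fun t => head (p, true) (q t)).
  left; exists D; split => //; apply: filterS2 Ucons UD => t /=.
  by case: (q t) => //= l w _ Dl; rewrite mem_set.
right; exists (a * b).
apply: countably_cvg_eq (countably_cvg_mul qa qb).
apply: filterS Ucons => t /=; case: (q t) => //= l w _.
exact: word_val_cons.
Qed.

End Dichotomy.

(** * Words in the free topological group *)

Section FreeTopologicalGroup.
Variables (X : topologicalType) (F : topologicalGroupType) (iota : X -> F).
Hypothesis F_free : is_free_topological_group iota.

Lemma iota_continuous : continuous iota.
Proof.
by apply/continuousP => A oA; apply/(ftg_subspace F_free); exists A.
Qed.

Lemma free_extension (G : topologicalGroupType) (f : X -> G) :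
  continuous f -> exists phi : F -> G, [/\ {morph phi : a b / a * b},
    continuous phi & forall w, phi (word_val iota w) = word_val f w].
Proof.
move=> /(ftg_extension F_free)[phi [[phiM cphi phif] _]]; exists phi; split => //.
by move=> w; rewrite -phif morph_word_val.
Qed.

Lemma exists_reduced_form : exists wd : F -> seq (X * bool),
  [/\ forall g, reduced (wd g), cancel wd (word_val iota) &
      forall w, reduced w -> wd (word_val iota w) = w].
Proof.
have /choice[wd hwd] g : exists w, reduced w /\ word_val iota w = g.
  by have [w [hw _]] := ftg_free_basis F_free g; exists w.
exists wd; split => [g|g|w rw]; [by case: (hwd g)|by case: (hwd g)|].
have [v [_ vuniq]] := ftg_free_basis F_free (word_val iota w).
by rewrite -(vuniq _ (hwd _)); exact: vuniq.
Qed.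

Variable wd : F -> seq (X * bool).
Hypothesis wd_reduced : forall g, reduced (wd g).
Hypothesis wdK : cancel wd (word_val iota).
Hypothesis wd_word_val : forall w, reduced w -> wd (word_val iota w) = w.

Section FarLetters.
Variables (U : set_system F) (g : F) (D : set X).
Hypothesis UP : ProperFilter U.
Hypothesis Ug : U --> g.
Hypothesis D_closed : closed D.
Hypothesis D_isolated : forall x, D x -> nbhs x [set x].
Hypothesis gND : {in wd g, forall l, l.1 \notin D}.
Hypothesis U_size : U [set u | (size (wd u) <= 4)%N].
Hypothesis U_far : U [set u | has (fun l => l.1 \in D) (wd u)].

(** The map of [X] to the discrete free group that collapses the complement of [D]
to [p] is continuous, so its extension is constant along [U]. *)
Lemma far_nested (p : X) : p \notin D -> U [set u | exists x s y t z,
  [/\ wd u = [:: (x, s); (y, t); (z, ~~ t); (x, ~~ s)],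
    x \in D, y \notin D & z \notin D]].
Proof.
move=> pND; pose r x := if x \in D then x else p.
pose f x : wreath F F := (fun=> 1, iota (r x)).
have cf : continuous f.
  have -> : f = fun x => if x \in D then wreath_top F (iota x)
      else wreath_top F (iota p).
    by apply/funext => x; rewrite /f /r /wreath_top; case: ifP.
  by apply: closed_isolated_split_continuous => //; exact: cst_continuous.
have [phi [phiM cphi phif]] := free_extension cf.
have phiE u : (phi u).2 = word_val iota [seq (r l.1, l.2) | l <- wd u].
  by rewrite -{1}(wdK u) phif -(morph_word_val (@wreath_sndM F F)) -word_val_map.
have : U [set u | (phi u).2 = (phi g).2].
  apply: (Ug (cphi g [set q | q.2 = (phi g).2] _)).
  by exists (fun=> setT) => // h; exact: filterT.
move: U_size U_far; apply: filterS3 => u su Du; rewrite /= !phiE => ug.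
by apply: (nested_cancellation (ftg_free_basis F_free) pND _ su Du gND ug).
Qed.

(** The map [kill] is the endomorphism that sends [D] to 1. The second map, to the
wreath product, sends [h * b * h^-1] to an element with coordinate [b] at the
index [h], and [g] to one whose coordinates are 1 except at the index 1; as
[h != 1], continuity forces [b] into [V h]. *)
Lemma far_conjugates (p : X) : p \notin D -> exists kill : F -> F,
  [/\ continuous kill, kill g = g &
   forall V : F -> set F, (forall h, nbhs 1 (V h)) -> U [set u | exists h b, [/\ u = h * b * h^-1, V h b, kill u = b &
     size (wd b) = 2%N]]].
Proof.
move=> pND.
pose f x : wreath F F := if x \in D then wreath_top F (iota x)
  else wreath_base F (iota x).
have cf : continuous f.
  apply: closed_isolated_split_continuous => // x.
  apply: (@continuous_comp _ _ _ iota (@wreath_base F F)).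
    exact: iota_continuous.
  exact: wreath_base_continuous.
have [phi [phiM cphi phif]] := free_extension cf.
have ckill0 : continuous (fun x => if x \in D then 1 else iota x).
  exact: (closed_isolated_split_continuous (f1 := fun=> 1 : F) D_closed
    D_isolated iota_continuous).
have [kill [killM ckill killf]] := free_extension ckill0.
exists kill; split => // [|V nV].
  rewrite -{1}(wdK g) killf -[RHS](wdK g); apply: eq_word_val => l /gND.
  by move=> /negbTE ->.
have phig : phi g = wreath_base F g.
  rewrite -{1}(wdK g) phif -[in RHS](wdK g).
  rewrite -(morph_word_val (@wreath_baseM F F)); apply: eq_word_val => l /gND.
  by rewrite /f => /negbTE ->.
have Uphi : U [set u | forall h, h != 1 -> V h ((phi u).1 h)].
  apply: (Ug (cphi g [set q | forall h, h != 1 -> V h (q.1 h)] _)).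
  rewrite phig; exists (fun h => if h == 1 then setT else V h) => h.
    by rewrite /=; case: ifP => _; [exact: filterT|exact: nV].
  by move=> vV h' /negbTE h'1; have := vV h'; rewrite h'1.
move: (far_nested pND) Uphi; apply: filterS2 => u.
move=> [x [s [y [t [z [wu xD yND zND]]]]]] phiV.
pose h := letter_val iota (x, s).
pose b := word_val iota [:: (y, t); (z, ~~ t)].
have uE : u = h * b * h^-1.
  rewrite -(wdK u) wu !word_val_cons word_val_nil mulg1 (letter_valN iota x s) -/h.
  by rewrite /b !word_val_cons word_val_nil mulg1 !mulgA.
have wb : wd b = [:: (y, t); (z, ~~ t)].
  apply: wd_word_val; have := wd_reduced u.
  by rewrite wu /reduced /= => /and4P[_ -> _ _].
have phih : phi h = wreath_top F h.
  have := phif [:: (x, s)]; rewrite !word_val_cons !word_val_nil !mulg1 -/h => ->.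
  rewrite -(morph_letter_val (@wreath_topM F F)) /letter_val /= /f xD.
  by [].
have phib : phi b = wreath_base F b.
  rewrite /b phif -(morph_word_val (@wreath_baseM F F)); apply: eq_word_val => l.
  by rewrite !inE => /orP[] /eqP -> /=; rewrite /f (negbTE yND, negbTE zND).
have killh : kill h = 1.
  have := killf [:: (x, s)]; rewrite !word_val_cons !word_val_nil !mulg1 -/h => ->.
  by rewrite /letter_val /= xD invg1; case: s {wu h uE phih}.
have killb : kill b = b.
  rewrite {1}/b killf; apply: eq_word_val => l.
  by rewrite !inE => /orP[] /eqP -> /=; rewrite (negbTE yND, negbTE zND).
exists h, b; split => //.
- have := phiV h (letter_val_neq1 (ftg_free_basis F_free) _).
  by rewrite uE !phiM (morphV phiM) phih phib wreath_conj.
- by rewrite uE !killM (morphV killM) killh killb invg1 mul1g mulg1.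
- by rewrite wb.
Qed.

End FarLetters.

Variable B : X -> nat -> set X.
Hypothesis B_nbhs : forall x k, nbhs x (B x k).
Hypothesis B_cvg : forall x (u : nat -> X), (forall k, B x k (u k)) -> u @ \oo --> x.
Hypothesis X_compact : compact (~` isolated [set: X]).
Variable p : X.

(** The alternative of [word_dichotomy] for an ultrafilter on [A] converging to [g].
The letters of [g] and the point [p] are put into the compact set so that [D]
avoids them. *)
Lemma far_or_sequence (A : set F) (g : F) (n : nat) :
  (forall a, A a -> (size (wd a) <= n)%N) -> closure A g ->
  (exists u : nat -> F, (forall k, A (u k)) /\ u @ \oo --> g) \/
  exists U D, [/\ ProperFilter U, U --> g, U A & [/\ closed D,
    forall x, D x -> nbhs x [set x], p \notin D,
    {in wd g, forall l, l.1 \notin D} &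
    U [set u | has (fun l => l.1 \in D) (wd u)]]].
Proof.
move=> Asize gA.
have [U [UU gAU]] : exists U, UltraFilter U /\ within A (nbhs g) `<=` U.
  have WP : ProperFilter (within A (nbhs g)) by exact: within_nbhs_proper.
  exact: ultraFilterLemma.
have UP : ProperFilter U by exact: ultra_proper.
have Ug : U --> g by move=> V gV; apply: gAU; rewrite /within /=; move: gV; apply: filterS.
have UA : U A by apply: gAU; exact: withinT.
pose L := ~` isolated [set: X] `|` [set` p :: map fst (wd g)].
have cL : compact L by apply: compactU => //; exact: finite_compact.
have [|[D [clD DL UD]]|[b cvgb]] :=
    @word_dichotomy X F iota B B_nbhs B_cvg iota_continuous F U L p UU cL n wd.
- by apply: filterS UA => a; exact: Asize.
- right; exists U, D; split; [exact: UP|exact: Ug|exact: UA|].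
  have DNL x : D x -> ~ L x by move=> Dx Lx; have : (D `&` L) x by []; rewrite DL.
  split; [exact: clD| | | |exact: UD].
  + move=> x Dx; have : isolated [set: X] x.
      by apply: contrapT => nx; apply: (DNL x Dx); left.
    by move=> [_ [V Vx]]; rewrite setIT => <-.
  + by rewrite notin_setE => /DNL; apply; right => /=; exact: mem_head.
  + move=> l lg; rewrite notin_setE => /DNL; apply; right => /=.
    by rewrite inE map_f ?orbT.
- left; have [E UE Eb] := cvgb.
  have /choice[u uAE] k : exists a, (A `&` E k) a.
    exact: (@filter_ex _ U UP _ (filterI UA (UE k))).
  exists u; split => [k|]; first by case: (uAE k).
  have ub : u @ \oo --> b.
    have /Eb : forall k, E k (u k) by move=> k; case: (uAE k).
    by have -> : (fun t => word_val iota (wd t)) \o u = u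
      by apply/funext => k /=; rewrite wdK.
  have Ub : id @ U --> b.
    have wd_id : (fun t => word_val iota (wd t)) = id :> (F -> F).
      by apply/funext => t; exact: wdK.
    by move: (countably_cvg_cvg (UP := UP) UU cvgb); rewrite wd_id.
  exact: cvg_trans ub (nbhs_sub_of_common_limit UP (f := id) Ug Ub).
Qed.

(** The nested shape takes four letters, so only convergent letters remain. *)
Lemma short_sequence (A : set F) (g : F) :
  (forall a, A a -> (size (wd a) < 4)%N) -> closure A g ->
  exists u : nat -> F, (forall k, A (u k)) /\ u @ \oo --> g.
Proof.
move=> Asize gA.
have [//|[U [D [UP Ug UA [clD isoD pND gND UD]]]]] :=
  far_or_sequence (n := 3) Asize gA.
have Us : U [set u | (size (wd u) <= 4)%N].
  by apply: filterS UA => a /Asize /ltnW.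
have := far_nested UP Ug clD isoD gND Us UD pND.
move=> /(filterI UA) /(@filter_ex _ U UP) [a [Aa [x [s [y [t [z [wa]]]]]]]].
by have := Asize _ Aa; rewrite wa.
Qed.

(** The second alternative of [far_or_sequence] is reduced to [short_sequence] by
conjugation with a single [h]. *)
Lemma length4_sequence (A : set F) (g : F) :
  (forall a, A a -> (size (wd a) <= 4)%N) -> closure A g ->
  exists u : nat -> F, (forall k, A (u k)) /\ u @ \oo --> g.
Proof.
move=> Asize gA.
have [//|[U [D [UP Ug UA [clD isoD pND gND UD]]]]] := far_or_sequence Asize gA.
have Us : U [set u | (size (wd u) <= 4)%N] by apply: filterS UA => a /Asize.
have [kill [ckill killg far]] := far_conjugates UP Ug clD isoD gND Us UD pND.
have ge : nbhs g `<=` nbhs (1 : F).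
  apply: (nbhs_sub_of_common_limit UP (f := kill)).
    by rewrite -killg; apply: (@cvg_comp _ _ _ id kill _ (nbhs g)) => //; exact: ckill.
  move=> V nV; change (U (kill @^-1` V)).
  have := far (fun=> V) (fun=> nV).
  by apply: filterS => u [h [b [_ Vb /= -> _]]].
(* If 1 were in no closure of [C h], neighbourhoods [V h] missing [C h] would
   contradict [far V]. *)
pose C h := [set b | A (h * b * h^-1) /\ size (wd b) = 2%N].
have [h Ch] : exists h, closure (C h) 1.
  apply: contrapT => noC.
  have /choice[V hV] h : exists V, nbhs (1 : F) V /\ C h `&` V = set0.
    apply: contrapT => noV; apply: noC; exists h => V nV.
    by apply/set0P/eqP => CV; apply: noV; exists V.
  have UV := far V (fun h => proj1 (hV h)).
  have [a [Aa [h [b [aE Vb _ sb]]]]] := @filter_ex _ U UP _ (filterI UA UV).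
  have : (C h `&` V h) b by split => //; split => //; rewrite -aE.
  by have [_ ->] := hV h.
have [|u [Cu u1]] := short_sequence _ Ch; first by move=> b [_ ->].
exists (fun k => h * u k * h^-1); split => [k|]; first by case: (Cu k).
have conj_cvg : (fun k => h * u k * h^-1) @ \oo --> h * 1 * h^-1.
  by apply: cvg_mulg; [apply: cvg_mulg => //|]; exact: cvg_cst.
by move: conj_cvg; rewrite mulg1 mulgV => /cvg_trans; apply.
Qed.

End FreeTopologicalGroup.

Theorem theorem2p6 (R : realType) (X : topologicalType)
    (X_nonempty : [set: X] !=set0)
    (X_metrizable : metrizable R X)
    (X_compact : compact (~` isolated [set: X]))
    (F : topologicalGroupType) (iota : X -> F)
    (F_free : is_free_topological_group iota) :
  frechet_urysohn (set_type (word_length_le iota 4)).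
Proof.
have [p _] := X_nonempty.
have [B [B_nbhs B_cvg]] := metrizable_countable_base X_metrizable.
have [wd [wd_reduced wdK wd_word_val]] := exists_reduced_form F_free.
move=> A y yA.
pose A' : set F := [set a | exists2 b, A b & set_val b = a].
have A'size a : A' a -> (size (wd a) <= 4)%N.
  move=> [b _ <-]; case: (set_valP b) => w [rw sw] wb.
  have -> : set_val b = word_val iota w by exact: esym wb.
  by rewrite wd_word_val.
have yA' : closure A' (set_val y).
  move=> V /initial_continuous yV.
  by have [b [Ab Vb]] := yA _ yV; exists (set_val b); split => //; exists b.
have [u [A'u uy]] := length4_sequence F_free wd_reduced wdK wd_word_val
  B_nbhs B_cvg X_compact p A'size yA'.
have /choice[v vE] k : exists b, A b /\ set_val b = u k.
  by have [b Ab bu] := A'u k; exists b.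
exists v; split => [k|]; first by case: (vE k).
move=> V [W [[C openC CW] Wy] WV].
have uC : \forall k \near \oo, C (u k).
  by apply: uy; apply: open_nbhs_nbhs; split => //; move: Wy; rewrite -CW.
change (\forall k \near \oo, V (v k)).
apply: filterS uC => k Cuk; apply: WV; rewrite -CW /=.
by case: (vE k) => _ ->.
Qed.
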